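(* Let $\sigma$ be the substitution on the alphabet $\{A,B,C,D\}$ given by $$\sigma:\quad A\mapsto ABDB,\quad B\mapsto ABAC,\quad C\mapsto DCDB,\quad D\mapsto DCAC,$$ and let $\mathbb{X}_\sigma$ be its two-sided hull. Equip the letters with the balanced weights $h(A)=h(B)=1$, $h(C)=h(D)=-1$. Then, for every $x\in\mathbb{X}_\sigma$, the diffraction measure $\widehat{\gamma}$ of the weighted Dirac comb $\omega_x=\sum_{n\in\mathbb{Z}} h(x_n)\,\delta_n$ is purely absolutely continuous with respect to Lebesgue measure on $\mathbb{R}$.
   Context: The two-sided hull $\mathbb{X}_\sigma$ is the set of all bi-infinite sequences $x=(x_n)_{n\in\mathbb{Z}}\in\{A,B,C,D\}^{\mathbb{Z}}$ such that every finite subword of $x$ occurs as a subword of $\sigma^k(A)$ for some $k\ge 1$. For $x\in\mathbb{X}_\sigma$ and $m\in\mathbb{Z}$, set $$\eta(m)=\lim_{N\to\infty}\frac{1}{2N+1}\sum_{n=-N}^{N} h(x_n)\,h(x_{n+m}).$$ This limit exists and is independent of the choice of $x\in\mathbb{X}_\sigma$. The autocorrelation of $\omega_x$ is the measure $\gamma=\sum_{m\in\mathbb{Z}}\eta(m)\,\delta_m$. The diffraction measure is its Fourier transform $\widehat{\gamma}$, which is a positive measure on $\mathbb{R}$. ''Purely absolutely continuous'' means that $\widehat{\gamma}$ has no pure point part and no singular continuous part with respect to Lebesgue measure. *)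

(* Defs.v *)
From HB Require Import structures.
From mathcomp Require Import all_boot all_order all_algebra.
From mathcomp Require Import complex.
From mathcomp Require Import all_classical all_reals all_analysis.
From mathcomp Require summability.

Set Implicit Arguments.
Unset Strict Implicit.
Unset Printing Implicit Defensive.

Import Order.TTheory GRing.Theory Num.Theory.
Import numFieldNormedType.Exports.

Local Open Scope classical_set_scope.
Local Open Scope ring_scope.

Inductive letter : Type := A | B | C | D.

Lemma letter_comparable : comparable letter.
Proof. by move=> a b; rewrite /decidable; decide equality. Qed.

HB.instance Definition _ :=
  hasDecEq.Build letter (compareP letter_comparable).

Definition sigma (a : letter) : seq letter :=
  match a with
  | A => [:: A; B; D; B]
  | B => [:: A; B; A; C]
  | C => [:: D; C; D; B]
  | D => [:: D; C; A; C]
  end.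

Definition sigma_word (w : seq letter) : seq letter := flatten (map sigma w).

Definition subword (x : int -> letter) (i : int) (l : nat) : seq letter :=
  [seq x (i + j%:Z) | j <- iota 0 l].

Definition hull : set (int -> letter) :=
  [set x | forall (i : int) (l : nat),
     exists2 k : nat, (1 <= k)%N & infix (subword x i l) (iter k sigma_word [:: A])].

Section diffraction.
Variable R : realType.

Definition weight (a : letter) : R :=
  match a with A | B => 1 | C | D => -1 end.

Definition corr_average (x : int -> letter) (m : int) (N : nat) : R :=
  (\sum_(j < N.*2.+1)
     weight (x (j%:Z - N%:Z)) * weight (x (j%:Z - N%:Z + m))) / N.*2.+1%:R.

Definition autocorrelation_coefs (x : int -> letter) (eta : int -> R) : Prop :=
  forall m : int, corr_average x m @ \oo --> eta m.

Definition cintegral (mu : {measure set (measurableTypeR R) -> \bar R})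
    (phi : R -> R[i]) : R[i] :=
  Complex (\int[mu]_t complex.Re (phi t)) (\int[mu]_t complex.Im (phi t)).

Definition cintegrable (mu : {measure set (measurableTypeR R) -> \bar R})
    (phi : R -> R[i]) : Prop :=
  mu.-integrable setT (fun t => (complex.Re (phi t))%:E) /\
  mu.-integrable setT (fun t => (complex.Im (phi t))%:E).

Definition real_schwartz (f : R -> R) : Prop :=
  (forall (n : nat) (t : R), derivable (derive1n n f) t 1) /\
  (forall k n : nat, exists M : R, forall t : R, `|t ^+ k * derive1n n f t| <= M).

Definition schwartz (phi : R -> R[i]) : Prop :=
  real_schwartz (fun t => complex.Re (phi t)) /\
  real_schwartz (fun t => complex.Im (phi t)).

(* exp (i theta) *)
Definition cis (theta : R) : R[i] := Complex (cos theta) (sin theta).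

Definition fourier (phi : R -> R[i]) (k : R) : R[i] :=
  cintegral (@lebesgue_measure R) (fun t => phi t * cis (- (2 * pi * k * t))).

(* The pairing of gamma = \sum_(m : int) eta m \delta_m with g equals v; the
   sum over int is unordered (limit along the net of finite subsets). *)
Definition comb_pairing (eta : int -> R) (g : R -> R[i]) (v : R[i]) : Prop :=
  (summability.partial_sum (fun m : int => eta m * complex.Re (g m%:~R))
     @ summability.totally --> complex.Re v) /\
  (summability.partial_sum (fun m : int => eta m * complex.Im (g m%:~R))
     @ summability.totally --> complex.Im v).

(* mu is the Fourier transform of gamma = \sum_m eta m \delta_m in the sense of
   tempered distributions: <mu, phi> = <gamma, fourier phi>. Integrability of
   every Schwartz function says that mu is tempered; it implies that mu is
   finite on bounded sets. *)
Definition fourier_transform_comb (eta : int -> R)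
    (mu : {measure set (measurableTypeR R) -> \bar R}) : Prop :=
  forall phi : R -> R[i], schwartz phi ->
    cintegrable mu phi /\ comb_pairing eta (fourier phi) (cintegral mu phi).

Definition diffraction_measure (x : int -> letter)
    (mu : {measure set (measurableTypeR R) -> \bar R}) : Prop :=
  exists2 eta : int -> R,
    autocorrelation_coefs x eta & fourier_transform_comb eta mu.

Definition pure_point (mu : {measure set (measurableTypeR R) -> \bar R}) : Prop :=
  exists2 S : set (measurableTypeR R), countable S & mu (~` S) = 0%E.

Definition no_atoms (mu : {measure set (measurableTypeR R) -> \bar R}) : Prop :=
  forall t : R, mu [set t] = 0%E.

Definition lebesgue_singular (mu : {measure set (measurableTypeR R) -> \bar R}) :
    Prop :=
  exists S : set (measurableTypeR R),
    [/\ measurable S, @lebesgue_measure R S = 0%E & mu (~` S) = 0%E].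

Definition lebesgue_decomposition
    (mu pp sc ac : {measure set (measurableTypeR R) -> \bar R}) : Prop :=
  [/\ forall S, measurable S -> mu S = (pp S + sc S + ac S)%E,
      pure_point pp,
      no_atoms sc /\ lebesgue_singular sc
    & ac `<< @lebesgue_measure R].

Definition is_zero_measure (mu : {measure set (measurableTypeR R) -> \bar R}) :
    Prop :=
  forall S, measurable S -> mu S = 0%E.

(* The first conjunct keeps the second one from holding vacuously. *)
Definition purely_absolutely_continuous
    (mu : {measure set (measurableTypeR R) -> \bar R}) : Prop :=
  (exists pp sc ac, lebesgue_decomposition mu pp sc ac) /\
  (forall pp sc ac, lebesgue_decomposition mu pp sc ac ->
     is_zero_measure pp /\ is_zero_measure sc).

End diffraction.

(* Main.v *)
(** Write a_n = h(u_n) for the fixed point u of sigma; the type of u_n ({A, D} or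
    {B, C}) is the parity of n, so a_{4n+j} is a_n up to a sign depending on j and
    (-1)^n only.  Splitting n modulo 4 gives linear recursions for the averages of
    a_n a_{n+m} and of (-1)^n a_n a_{n+m}; solving them by induction on m, both
    vanish except for the first one at m = 0.  All bounds are uniform over
    windows, so they pass to every x in the hull, and gamma = delta_0.  Hence
    Lebesgue measure is a diffraction measure.  Any other one has the same
    integrals of Schwartz functions; smooth compactly supported functions
    increasing to the indicator of an open interval show that it is Lebesgue
    measure. *)

Require Import Defs.
From mathcomp Require Import all_boot all_order all_algebra.
From mathcomp Require Import complex finmap.
From mathcomp Require Import all_classical all_reals all_analysis.
From mathcomp Require Import measurable_realfun.
From mathcomp Require summability.
From mathcomp Require Import ring lra zify.

Set Implicit Arguments.
Unset Strict Implicit.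
Unset Printing Implicit Defensive.

Import Order.TTheory GRing.Theory Num.Theory.
Import numFieldNormedType.Exports.

Local Open Scope classical_set_scope.
Local Open Scope ring_scope.

(** * The autocorrelation of the hull *)

(** The [k] lowest base 4 digits of [n] select the letter: for [n < 4 ^ k] it is letter [n] of the
    [k]-th iterate of [sigma] on [A]. *)
Fixpoint fixed_letter (k n : nat) : letter :=
  if k is k'.+1 then nth A (sigma (fixed_letter k' (n %/ 4))) (n %% 4) else A.

Lemma sigma_word_mkseq (f : nat -> letter) n :
  sigma_word (mkseq f n) =
  mkseq (fun i => nth A (sigma (f (i %/ 4)%N)) (i %% 4)) (n * 4).
Proof.
elim: n => [//|n IHn].
rewrite mkseqS /sigma_word map_rcons flatten_rcons -/(sigma_word _) IHn.
rewrite mulSnr addn4 !mkseqS -!cats1 -!catA /=; congr cat.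
have [q1 r1] : ((n * 4).+1 %/ 4 = n)%N /\ ((n * 4).+1 %% 4 = 1)%N by lia.
have [q2 r2] : ((n * 4).+2 %/ 4 = n)%N /\ ((n * 4).+2 %% 4 = 2)%N by lia.
have [q3 r3] : ((n * 4).+3 %/ 4 = n)%N /\ ((n * 4).+3 %% 4 = 3)%N by lia.
rewrite q1 q2 q3 r1 r2 r3 mulnK // modnMl.
by case: (f n).
Qed.

Lemma iter_sigma_word k :
  iter k sigma_word [:: A] = mkseq (fixed_letter k) (4 ^ k).
Proof. by elim: k => [//|k IHk]; rewrite iterS IHk sigma_word_mkseq expnSr. Qed.

(** [sigma A] begins with [A], so each iterate is a prefix of the next: a leading digit 0 changes
    nothing. *)
Lemma fixed_letterS k n :
  (n < 4 ^ k)%N -> fixed_letter k.+1 n = fixed_letter k n.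
Proof.
elim: k n => [|k IHk] n; first by rewrite expn0; case: n.
move=> nk; have {IHk} := IHk (n %/ 4)%N; rewrite ltn_divLR // -expnSr nk.
by move=> /(_ isT) IHk; rewrite [RHS]/= -IHk.
Qed.

(** Since [n < 4 ^ n], [n] iterations already fix the letter at position [n]. *)
Definition fixed_point (n : nat) : letter := fixed_letter n n.

Lemma fixed_pointE k n : (n < 4 ^ k)%N -> fixed_letter k n = fixed_point n.
Proof.
have stable j l : (n < 4 ^ j)%N -> fixed_letter (l + j) n = fixed_letter j n.
  move=> nj; elim: l => [//|l IHl].
  by rewrite addSn fixed_letterS // (leq_trans nj) // leq_exp2l // leq_addl.
move=> nk; rewrite /fixed_point -(stable k n) // -(stable n k) 1?addnC //.
exact: ltn_expl.
Qed.

Lemma fixed_point_rec n j : (j < 4)%N ->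
  fixed_point (n * 4 + j) = nth A (sigma (fixed_point n)) j.
Proof.
move=> j4; have lt : (n < 4 ^ n)%N by exact: ltn_expl.
rewrite -(@fixed_pointE n.+1); last by rewrite expnSr; lia.
rewrite /= divnMDl // divn_small // addn0 modnMDl modn_small //.
Qed.

(** * Signs of the fixed point *)

Section correlations.
Variable R : realType.

Definition usign (n : nat) : R := weight R (fixed_point n).
Definition alt (n : nat) : R := (-1) ^+ n.

Lemma usign_sqr n : usign n * usign n = 1.
Proof. by rewrite /usign; case: fixed_point; rewrite /= ?mulrNN mulr1. Qed.

Lemma alt_sqr n : alt n * alt n = 1.
Proof. by rewrite /alt -exprD addnn -mul2n exprM sqrrN !expr1n. Qed.

Lemma altD m n : alt (m + n) = alt m * alt n. Proof. exact: exprD. Qed.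

Lemma alt4 n : alt (n * 4) = 1.
Proof. by rewrite /alt mulnC exprM (_ : (-1) ^+ 4 = 1 :> R) ?expr1n //; ring. Qed.

(** All four images under [sigma] have [A] or [D] at even places and [B] or [C] at odd ones. *)
Lemma fixed_point_alt n :
  alt n = (match fixed_point n with A | D => 1 | B | C => -1 end : R).
Proof.
rewrite (divn_eq n 4) altD alt4 mul1r fixed_point_rec ?ltn_mod //.
have := ltn_pmod n (isT : 0 < 4)%N.
by case: (n %% 4)%N => [|[|[|[|[]]]]] // _; case: fixed_point; rewrite /alt /=; ring.
Qed.

Lemma usign0 n : usign (n * 4) = usign n.
Proof. by rewrite /usign -[(n * 4)%N]addn0 fixed_point_rec //; case: fixed_point. Qed.
Lemma usign1 n : usign (n * 4 + 1) = usign n.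
Proof. by rewrite /usign fixed_point_rec //; case: fixed_point. Qed.
(** The sign change in the second half of an image depends only on the type of the letter, which
    [fixed_point_alt] turns into the parity of [n]. *)
Lemma usign2 n : usign (n * 4 + 2) = - alt n * usign n.
Proof.
rewrite /usign fixed_point_rec // fixed_point_alt.
by case: fixed_point => /=; ring.
Qed.
Lemma usign3 n : usign (n * 4 + 3) = alt n * usign n.
Proof.
rewrite /usign fixed_point_rec // fixed_point_alt.
by case: fixed_point => /=; ring.
Qed.

(** * Window sums and vanishing means *)

Definition window (F : nat -> R) (p L : nat) : R := \sum_(i < L) F (p + i)%N.

Definition block (F : nat -> R) (n : nat) : R :=
  F (n * 4)%N + F (n * 4 + 1)%N + F (n * 4 + 2)%N + F (n * 4 + 3)%N.

Lemma windowS F p L : window F p L.+1 = window F p L + F (p + L)%N.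
Proof. by rewrite /window big_ord_recr. Qed.

Lemma windowD F p L l :
  window F p (L + l) = window F p L + window F (p + L) l.
Proof.
elim: l => [|l IHl]; first by rewrite addn0 {3}/window big_ord0 addr0.
by rewrite addnS !windowS IHl addnA addrA.
Qed.

Lemma window_block F p L : window F (p * 4) (L * 4) = window (block F) p L.
Proof.
elim: L => [|L IHL]; first by rewrite /window !big_ord0.
rewrite windowS -IHL mulSnr addn4 !windowS /block.
rewrite -!addrA; congr (_ + (F _ + (F _ + (F _ + F _)))); lia.
Qed.

Lemma window_le F p L : (forall n, `|F n| <= 1) -> `|window F p L| <= L%:R.
Proof.
move=> F1; apply: le_trans (ler_norm_sum _ _ _) _.
by rewrite -[X in X%:R](card_ord L) -sumr_const ler_sum.
Qed.

Lemma window_trim F p L : (forall n, `|F n| <= 1) ->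
  `|window F p L| <= 9 + `|window (block F) (p %/ 4) (L %/ 4)|.
Proof.
move=> F1; rewrite -window_block; set q := (p %/ 4)%N; set M := (L %/ 4)%N.
have e1 : (L = M * 4 + L %% 4)%N by exact: divn_eq.
have e2 : (p = q * 4 + p %% 4)%N by exact: divn_eq.
have le3 n : ((n %% 4)%:R : R) <= 3 by rewrite ler_nat; lia.
have w1 := window_le (q * 4) (p %% 4) F1.
have w2 := window_le (q * 4 + L) (p %% 4) F1.
have w3 := window_le (q * 4 + M * 4) (L %% 4) F1.
(* The window is slid left to the block boundary [q * 4]. The three correction pieces have at most 3
   terms each, whence the 9. *)
have E : window F p L = window F (q * 4) (M * 4)
   + window F (q * 4 + M * 4) (L %% 4) + window F (q * 4 + L) (p %% 4)
   - window F (q * 4) (p %% 4).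
  rewrite -windowD -e1 -windowD [(L + _)%N]addnC windowD -e2; ring.
rewrite E; move: w1 w2 w3 (le3 p) (le3 L).
move: (window F (q * 4) (M * 4)) (window F (q * 4 + M * 4) (L %% 4)).
move: (window F (q * 4 + L) (p %% 4)) (window F (q * 4) (p %% 4)) => c d a b.
move: ((p %% 4)%:R : R) ((L %% 4)%:R : R) => r r'.
rewrite !ler_norml => /andP[? ?] /andP[? ?] /andP[? ?] ? ?.
by case: (ler0P a) => ?; apply/andP; split; lra.
Qed.

(** Mean value zero, uniformly in the position: [K] may depend on [e] but not on [p], since windows
    of a hull element sit at unknown places of the fixed point. *)
Definition null (F : nat -> R) : Prop := forall e : R, 0 < e ->
  exists K : R, forall p L, `|window F p L| <= e * L%:R + K.

Lemma null_ext F G : F =1 G -> null F -> null G.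
Proof. by move=> /funext ->. Qed.

Lemma null0 : null (fun=> 0).
Proof.
move=> e e0; exists 0 => p L.
by rewrite /window big1 // normr0 addr0 mulr_ge0 // ltW.
Qed.

Lemma nullD F G : null F -> null G -> null (fun n => F n + G n).
Proof.
move=> nF nG e e0; have e20 : 0 < e / 2 by rewrite divr_gt0.
have [K KF] := nF _ e20; have [K' KG] := nG _ e20.
exists (K + K') => p L.
have := KF p L; have := KG p L; have := ler_normD (window F p L) (window G p L).
by rewrite /window -big_split /=; lra.
Qed.

Lemma nullZ c F : null F -> null (fun n => c * F n).
Proof.
move=> nF e e0; have c0 : 0 < `|c| + 1 by rewrite ltr_wpDl.
have [|K KF] := nF (e / (`|c| + 1)); first by rewrite divr_gt0.
exists ((`|c| + 1) * K) => p L.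
have -> : window (fun n => c * F n) p L = c * window F p L.
  by rewrite /window mulr_sumr.
rewrite normrM; apply: (@le_trans _ _ ((`|c| + 1) * `|window F p L|)).
  by rewrite ler_wpM2r // lerDl.
apply: le_trans (ler_wpM2l (ltW c0) (KF p L)) _.
by rewrite mulrDr !mulrA [(_ + 1) * e]mulrC mulfK ?gt_eqF.
Qed.

Lemma null_block F : (forall n, `|F n| <= 1) -> null (block F) -> null F.
Proof.
move=> F1 nF e e0; have [K KF] := nF _ e0; exists (9 + K) => p L.
apply: le_trans (window_trim p L F1) _.
have := KF (p %/ 4)%N (L %/ 4)%N.
have : e * (L %/ 4)%:R <= e * L%:R by rewrite ler_pM2l // ler_nat leq_div.
lra.
Qed.

(* Iterating the trimmed block bound k times gains a factor 2^-k, since the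
   window shrinks by 4 each time while F reappears with coefficient -1. *)
Lemma null_block_self F G : (forall n, `|F n| <= 1) -> null G ->
  (forall n, block F n = G n - F n) -> null F.
Proof.
move=> F1 nG FG.
have step k : exists K : R, forall p L,
    `|window F p L| <= 2 ^- k * L%:R + K.
  elim: k => [|k [K KF]].
    by exists 0 => p L; rewrite expr0 invr1 mul1r addr0 window_le.
  have e0 : 0 < 2 ^- k.+1 :> R by rewrite invr_gt0 exprn_gt0.
  have [K' KG] := nG _ e0.
  exists (9 + K + K') => p L; apply: le_trans (window_trim p L F1) _.
  set q := (p %/ 4)%N; set M := (L %/ 4)%N.
  have -> : window (block F) q M = window G q M - window F q M.
    by rewrite /window -sumrB; apply: eq_bigr => i _.
  have := ler_normB (window G q M) (window F q M).
  have := KF q M; have := KG q M.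
  (* The bounds for [G] and [F] have slopes [2 ^- k.+1] and [2 * 2 ^- k.+1] in [M]; their sum 3
     stays below the 4 available here. *)
  have : 2 ^- k.+1 * (M * 4)%:R <= 2 ^- k.+1 * L%:R :> R.
    by rewrite ler_pM2l // ler_nat leq_trunc_div.
  have Mge0 : 0 <= 2 ^- k.+1 * M%:R :> R by rewrite mulr_ge0 // ltW.
  have -> : 2 ^- k = 2 * 2 ^- k.+1 :> R by rewrite exprS invfM mulrA divff ?mul1r.
  by rewrite natrM mulrA -[2 * _ * _]mulrA; lra.
move=> e e0; have [k ke] : exists k, 2 ^- k <= e :> R.
  exists (Num.trunc e^-1).+1; rewrite -[leRHS]invrK lef_pV2 ?posrE ?exprn_gt0 ?invr_gt0 //.
  have := truncnS_gt e^-1; set t := (Num.trunc _).+1 => /ltW/le_trans; apply.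
  by rewrite -natrX ler_nat ltnW // ltn_expl.
have [K KF] := step k; exists K => p L; apply: le_trans (KF p L) _.
by rewrite lerD2r ler_wpM2r.
Qed.

(** * Recursions for the correlations *)

Definition corr (m n : nat) : R := usign n * usign (n + m)%N.
(** The factors [alt n] in [usign2] and [usign3] bring in this twisted family; together with [corr]
    it is closed under taking blocks. *)
Definition altcorr (m n : nat) : R := alt n * corr m n.

Lemma normr_usign n : `|usign n| = 1.
Proof. by rewrite /usign; case: fixed_point; rewrite /= ?normrN normr1. Qed.

Lemma normr_corr m n : `|corr m n| <= 1.
Proof. by rewrite /corr normrM !normr_usign mulr1. Qed.

Lemma normr_altcorr m n : `|altcorr m n| <= 1.
Proof. by rewrite /altcorr normrM normrX normrN1 expr1n mul1r normr_corr. Qed.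

Lemma alt_block n :
  [/\ alt (n * 4) = 1, alt (n * 4 + 1) = -1, alt (n * 4 + 2) = 1 &
      alt (n * 4 + 3) = -1].
Proof. by rewrite !altD alt4 /alt; split; ring. Qed.

Lemma usign_lo n m i j :
  usign (n * 4 + i + (m * 4 + j)) = usign ((n + m) * 4 + (i + j)).
Proof. by congr usign; lia. Qed.

(** A carry into the next block raises the shift, which is how [m.+1] enters the recursions. *)
Lemma usign_hi n m i j l : (i + j = l + 4)%N ->
  usign (n * 4 + i + (m * 4 + j)) = usign ((n + m.+1) * 4 + l).
Proof. by move=> ijl; congr usign; lia. Qed.

Lemma block_corr0 m n :
  block (corr (m * 4)) n = (2 + 2 * alt m) * corr m n /\
  block (altcorr (m * 4)) n = 0.
Proof.
have [a0 a1 a2 a3] := alt_block n.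
have e0 : usign (n * 4 + m * 4) = usign (n + m) by rewrite -mulnDl usign0.
have e j : usign (n * 4 + j + m * 4) = usign ((n + m) * 4 + j).
  by congr usign; lia.
rewrite /block /altcorr /corr a0 a1 a2 a3 e0 !e.
rewrite !usign0 !usign1 !usign2 !usign3 altD.
by split; ring: (alt_sqr n).
Qed.

Lemma block_corr1 m n :
  block (corr (m * 4 + 1)) n =
    (1 - alt m) * corr m n - alt m * altcorr m n + altcorr m.+1 n /\
  block (altcorr (m * 4 + 1)) n =
    (1 - alt m) * corr m n + alt m * altcorr m n - altcorr m.+1 n.
Proof.
have [a0 a1 a2 a3] := alt_block n.
have e0 := usign_lo n m 0 1; rewrite addn0 in e0.
rewrite /block /altcorr /corr a0 a1 a2 a3 e0 (@usign_hi n m 3 1 0) // !usign_lo.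
rewrite !addn0 !usign0 !usign1 !usign2 !usign3 altD.
by split; ring: (alt_sqr n).
Qed.

Lemma block_corr2 m n :
  block (corr (m * 4 + 2)) n = 0 /\
  block (altcorr (m * 4 + 2)) n = -2 * alt m * altcorr m n - 2 * altcorr m.+1 n.
Proof.
have [a0 a1 a2 a3] := alt_block n.
have e0 := usign_lo n m 0 2; rewrite addn0 in e0.
rewrite /block /altcorr /corr a0 a1 a2 a3 e0 (@usign_lo n m 1).
rewrite (@usign_hi n m 2 2 0) // (@usign_hi n m 3 2 1) //.
rewrite !addn0 !usign0 !usign1 !usign2 !usign3 altD.
by split; ring: (alt_sqr n).
Qed.

Lemma block_corr3 m n :
  block (corr (m * 4 + 3)) n =
    alt m * altcorr m n + (1 - alt m.+1) * corr m.+1 n - altcorr m.+1 n /\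
  block (altcorr (m * 4 + 3)) n =
    alt m * altcorr m n - (1 - alt m.+1) * corr m.+1 n - altcorr m.+1 n.
Proof.
have [a0 a1 a2 a3] := alt_block n.
have e0 := usign_lo n m 0 3; rewrite addn0 in e0.
rewrite /block /altcorr /corr a0 a1 a2 a3 e0.
rewrite (@usign_hi n m 1 3 0) // (@usign_hi n m 2 3 1) // (@usign_hi n m 3 3 2) //.
rewrite !addn0 !usign0 !usign1 !usign2 !usign3 !altD.
by split; ring: (alt_sqr n).
Qed.

(** Strong induction on [m = 4q + r]. For [m > 1] the block sums involve only smaller shifts, [q]
    and possibly [q.+1]; [corr 0] is constantly 1, hence the restriction on [corr]. *)
Lemma null_corr m :
  ((0 < m)%N -> null (corr m)) /\ null (altcorr m).
Proof.
have altcorr0 : null (altcorr 0).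
  apply: null_block; first exact: normr_altcorr.
  by apply: null_ext null0 => n; have [_ ->] := block_corr0 0 n.
elim/ltn_ind: m => m IHm.
(* The coefficient [1 - alt m] vanishes at [m = 0], where [corr 0] is not null. *)
have lowcorr k : (k < m)%N -> null (fun n => (1 - alt k) * corr k n).
  case: k => [|k] km; first by apply: null_ext null0 => n; rewrite /alt expr0 subrr mul0r.
  exact/nullZ/(IHm _ km).1.
have lowalt k c : (k < m)%N -> null (fun n => c * altcorr k n).
  by move=> km; exact/nullZ/(IHm _ km).2.
(* Here [q.+1] is 1 itself: the block of [altcorr 1] is [altcorr 0 - altcorr 1], the case that
   [null_block_self] handles. *)
have [m1|m1] := eqVneq m 1%N.
  have alt1 : null (altcorr 1).
    apply: (null_block_self (normr_altcorr 1) altcorr0) => n.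
    by have [_ ->] := block_corr1 0 n; rewrite /alt expr0; ring.
  rewrite m1; split => // _; apply: null_block; first exact: normr_corr.
  apply: null_ext (nullD (nullZ (-1) altcorr0) alt1) => n.
  by have [-> _] := block_corr1 0 n; rewrite /alt expr0; ring.
have [q [r [r4 mE]]] : exists q r, (r < 4)%N /\ m = (q * 4 + r)%N.
  by exists (m %/ 4)%N, (m %% 4)%N; rewrite ltn_mod -divn_eq.
have nullbc : ((0 < m)%N -> null (block (corr m))) /\ null (block (altcorr m)).
  case: r r4 mE => [|[|[|[|//]]]] _ mE.
  - rewrite addn0 in mE; rewrite mE; split.
      move=> q0; have [qm q1] : (q < m)%N /\ (0 < q)%N by lia.
      apply: null_ext (nullZ (2 + 2 * alt q) ((IHm q qm).1 q1)) => n.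
      by have [-> _] := block_corr0 q n.
    by apply: null_ext null0 => n; have [_ ->] := block_corr0 q n.
  - have [qm q1m] : (q < m)%N /\ (q.+1 < m)%N by lia.
    rewrite mE; split => [_|].
      apply: null_ext (nullD (nullD (lowcorr _ qm) (lowalt _ (- alt q) qm))
                             (lowalt _ 1 q1m)) => n.
      by have [-> _] := block_corr1 q n; ring.
    apply: null_ext (nullD (nullD (lowcorr _ qm) (lowalt _ (alt q) qm))
                           (lowalt _ (-1) q1m)) => n.
    by have [_ ->] := block_corr1 q n; ring.
  - have [qm q1m] : (q < m)%N /\ (q.+1 < m)%N by lia.
    rewrite mE; split => [_|].
      by apply: null_ext null0 => n; have [-> _] := block_corr2 q n.
    apply: null_ext (nullD (lowalt _ (-2 * alt q) qm) (lowalt _ (-2) q1m)) => n.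
    by have [_ ->] := block_corr2 q n; ring.
  - have [qm q1m] : (q < m)%N /\ (q.+1 < m)%N by lia.
    rewrite mE; split => [_|].
      apply: null_ext (nullD (nullD (lowalt _ (alt q) qm) (lowcorr _ q1m))
                             (lowalt _ (-1) q1m)) => n.
      by have [-> _] := block_corr3 q n; ring.
    apply: null_ext (nullD (nullD (lowalt _ (alt q) qm) (nullZ (-1) (lowcorr _ q1m)))
                           (lowalt _ (-1) q1m)) => n.
    by have [_ ->] := block_corr3 q n; ring.
split=> [m0|]; apply: null_block.
- exact: normr_corr.
- exact: nullbc.1.
- exact: normr_altcorr.
- exact: nullbc.2.
Qed.

(** * Transfer to the hull *)

(** A subword occurs in some iterate on [A], which is a prefix of the fixed point; [p] is the length
    of what precedes the occurrence. *)
Lemma hull_window (x : int -> letter) (i : int) (l : nat) : hull x ->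
  exists p : nat, forall j, (j < l)%N -> x (i + j%:Z) = fixed_point (p + j).
Proof.
move=> /(_ i l)[k _]; rewrite iter_sigma_word => /infixP[s [t e]].
exists (size s) => j jl.
have szs : size (subword x i l) = l by rewrite size_map size_iota.
have pl : (size s + j < 4 ^ k)%N.
  rewrite -(size_mkseq (fixed_letter k) (4 ^ k)) e !size_cat szs.
  by rewrite ltn_add2l ltn_addr.
rewrite -(fixed_pointE pl) -(nth_mkseq A _ pl) e nth_cat ltnNge leq_addr /=.
by rewrite addKn nth_cat szs jl (nth_map 0%N) ?size_iota // nth_iota.
Qed.

Lemma corr_averageE (x : int -> letter) (m : int) N : hull x ->
  exists p : nat, corr_average R x m N = window (corr `|m|%N) p N.*2.+1 / N.*2.+1%:R.
Proof.
move=> hx; case: m => m.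
  have [p xp] := hull_window (- N%:Z) (N.*2.+1 + m) hx.
  exists p; congr (_ / _); apply: eq_bigr => j _; rewrite /corr /usign.
  rewrite [j%:Z - _]addrC -addrA -PoszD !xp ?addnA //.
    by rewrite ltn_add2r.
  exact: ltn_addr.
(* For a negative shift the window starts at the shifted end and the factors are swapped, which
   makes the shift [m.+1]. *)
have [p xp] := hull_window (- N%:Z + Negz m) (N.*2.+1 + m.+1) hx.
exists p; congr (_ / _); apply: eq_bigr => j _; rewrite /corr /usign /=.
rewrite mulrC; congr (weight _ _ * weight _ _).
  rewrite -xp; last by have := ltn_ord j; lia.
  by congr x; lia.
rewrite -addnA -xp; last by have := ltn_ord j; lia.
by congr x; lia.
Qed.

Definition delta0 (m : int) : R := (m == 0)%:R.

Lemma hull_autocorrelation (x : int -> letter) :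
  hull x -> autocorrelation_coefs x delta0.
Proof.
move=> hx m; rewrite /delta0; have [->|m0] := eqVneq m 0.
  apply: cvg_near_cst; near=> N.
  have [p ->] := corr_averageE 0 N hx.
  rewrite /window (eq_bigr (fun=> 1)) ?sumr_const ?card_ord ?divff ?pnatr_eq0 //.
  by move=> i _; rewrite /corr addn0 usign_sqr.
apply/cvgrPdist_le => e e0.
(* Half of [e] is the slope of the window bound; the other half absorbs [K] once [N] is large. *)
have e20 : 0 < e / 2 by rewrite divr_gt0.
have [K KF] := (null_corr `|m|).1 (ltac:(lia)) _ e20.
near=> N; rewrite sub0r normrN.
have [p ->] := corr_averageE m N hx.
rewrite normf_div (ger0_norm (ler0n _ _)) ler_pdivrMr ?ltr0n //.
apply: le_trans (KF _ _) _; rewrite -lerBrDl -mulrBl.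
have -> : e - e / 2 = e / 2 by field.
rewrite mulrC -ler_pdivrMr //.
apply: (@le_trans _ _ (N%:R : R)); last by rewrite ler_nat -addnn; lia.
near: N; exact: nbhs_infty_ger.
Unshelve. all: by end_near. Qed.

End correlations.

(** * Smooth approximations of intervals *)

Section bump.
Variable R : realType.
Implicit Types (a b s x : R) (f g : R -> R).

(** The classical smooth function [exp (- s / x)] extended by 0. The factor [x ^- k] closes the
    family under differentiation up to linear combinations. *)
Definition flat (s : R) (k : nat) (x : R) : R :=
  if 0 < x then x^-1 ^+ k * expR (- s * x^-1) else 0.

Lemma flat0 s k x : x <= 0 -> flat s k x = 0.
Proof. by rewrite /flat leNgt => /negbTE ->. Qed.

Lemma flat_ge0 s k x : 0 <= flat s k x.
Proof.
rewrite /flat; case: ifP => // x0.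
by rewrite mulr_ge0 ?expR_ge0 // exprn_ge0 // invr_ge0 ltW.
Qed.

(** The term of degree [k.+2] of the exponential series bounds [expR (s / x)] from below, leaving a
    spare [x ^+ 2]. *)
Lemma flat_le_sqr s k : 0 < s ->
  exists K : R, forall x, `|flat s k x| <= K * x ^+ 2.
Proof.
move=> s0; exists (k.+2`!%:R / s ^+ k.+2) => x.
rewrite (ger0_norm (flat_ge0 _ _ _)) /flat; case: ifPn => [x0|_]; last first.
  by rewrite mulr_ge0 ?sqr_ge0 // divr_ge0 // exprn_ge0 // ltW.
have y0 : 0 < x^-1 by rewrite invr_gt0.
have := @expR_ge1Dxn R (s * x^-1) k.+1 (mulr_ge0 (ltW s0) (ltW y0)).
rewrite mulNr expRN => le1.
have {le1} le1 : (s * x^-1) ^+ k.+2 / k.+2`!%:R <= expR (s * x^-1).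
  by apply: le_trans le1; rewrite lerDr.
have xk : (x ^+ k.+2) != 0 by rewrite expf_neq0 // gt_eqF.
have fk : (k.+2`!%:R : R) != 0 by rewrite pnatr_eq0 -lt0n fact_gt0.
rewrite ler_pdivrMr ?expR_gt0 //.
apply: le_trans (ler_wpM2l _ le1); last first.
  by rewrite mulr_ge0 ?sqr_ge0 // divr_ge0 // exprn_ge0 // ltW.
rewrite le_eqVlt; apply/orP; left; apply/eqP.
rewrite exprMn exprVn exprVn -[k.+2]addn2 exprD [x ^+ (k + 2)]exprD.
field.
by rewrite !expf_neq0 ?gt_eqF // pnatr_eq0 -lt0n fact_gt0.
Qed.

Lemma is_derive_flat_gt0 (s : R) k (x : R) : 0 < x ->
  is_derive x 1 (fun y => y^-1 ^+ k * expR (- s * y^-1))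
    (- k%:R * flat s k.+1 x + s * flat s k.+2 x).
Proof.
move=> x0; have xN0 : x != 0 by rewrite gt_eqF.
have dV : is_derive x 1 (fun y : R => y^-1) (- x ^- 2 *: 1).
  exact: (@is_deriveV _ id).
have dP := @is_deriveX _ _ _ k _ _ _ dV.
have dE := @is_derive1_comp _ expR _ x _ _ (is_derive_expR _)
  (@is_deriveZ _ _ _ _ (- s) _ _ _ dV).
have dM := @is_deriveM _ _ _ _ _ _ _ _ dP dE.
have -> : (fun y => y^-1 ^+ k * expR (- s * y^-1)) =
    (fun y => y^-1) ^+ k * (expR \o (- s) \*: (fun y : R => y^-1)).
  by apply/funext => y; rewrite /= !fctE.
apply: is_derive_eq; rewrite !fctE /GRing.scale /= /flat x0 /= mulr1 -exprVn.
by case: k {dP dM} => [|k]; rewrite ?exprS /=; ring.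
Qed.

Lemma is_derive_flat s k (x : R) : 0 < s ->
  is_derive x 1 (flat s k) (- k%:R * flat s k.+1 x + s * flat s k.+2 x).
Proof.
move=> s0; have [x0|x0|->] := ltgtP x 0.
- rewrite !flat0 ?ltW // !mulr0 addr0.
  apply: (@near_eq_is_derive _ _ _ (cst (0 : R))).
  by near=> y; rewrite flat0 // ltW //; near: y; exact: lt_nbhsl.
- apply: near_eq_is_derive (is_derive_flat_gt0 s k x0).
  near=> y; rewrite /flat ifT //; near: y; exact: lt_nbhsr.
rewrite !flat0 // !mulr0 addr0; have [K flatK] := flat_le_sqr k s0.
(* By the quadratic bound, the difference quotient at 0 is at most a multiple of [|h|]. *)
have cv : h^-1 *: (flat s k (h *: 1 + 0) - flat s k 0) @[h --> 0^'] --> (0 : R).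
  rewrite flat0 //; apply/cvgrPdist_le => e e0.
  near=> h; rewrite sub0r normrN subr0 addr0 /GRing.scale /= mulr1 normrM normfV.
  have h0 : h != 0 by near: h; exact: nbhs_dnbhs_neq.
  rewrite ler_pdivrMl ?normr_gt0 //; apply: le_trans (flatK h) _.
  rewrite -[h ^+ 2]ger0_norm ?sqr_ge0 // normrX expr2 mulrCA ler_wpM2l //.
  apply: (@le_trans _ _ ((`|K| + 1) * `|h|)).
    by rewrite ler_wpM2r // (le_trans (ler_norm K)) // lerDl.
  rewrite -ler_pdivlMl; last by rewrite ltr_wpDl.
  near: h; apply: dnbhs0_le; rewrite mulr_gt0 // invr_gt0 ltr_wpDl //.
by apply: DeriveDef; [apply/cvg_ex; exists 0|exact: cvg_lim].
Unshelve. all: by end_near. Qed.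

(** A syntactic class stable under derivation, so that all derivatives are handled without a formula
    for them. *)
Inductive bump (a b s : R) : (R -> R) -> Prop :=
| Bump_prod c j k : bump a b s (fun x => c * (flat s j (x - a) * flat s k (b - x)))
| Bump_add f g : bump a b s f -> bump a b s g -> bump a b s (fun x => f x + g x).

Lemma bump_eq0 a b s f x : bump a b s f -> ~~ (a < x < b) -> f x = 0.
Proof.
move=> bf xab; elim: bf => [c j k|g h _ -> _ ->]; last by rewrite addr0.
move: xab; rewrite negb_and -!leNgt => /orP[xa|bx].
  by rewrite flat0 ?subr_le0 // mul0r mulr0.
by rewrite [flat _ _ (b - x)]flat0 ?subr_le0 // !mulr0.
Qed.

Lemma bump_derive a b s f : 0 < s -> bump a b s f ->
  exists2 g, bump a b s g & forall x : R, is_derive x 1 f (g x).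
Proof.
move=> s0; elim => [c j k|f1 f2 _ [g1 b1 d1] _ [g2 b2 d2]]; last first.
  exists (fun x => g1 x + g2 x); first exact: Bump_add.
  by move=> x; exact: is_deriveD.
(* Product rule: two terms from the factor in [x - a], two from the factor in [b - x], whose inner
   derivative flips the signs. *)
eexists.
  apply: Bump_add; first apply: Bump_add; last apply: Bump_add.
  - exact: (Bump_prod a b s (c * - j%:R) j.+1 k).
  - exact: (Bump_prod a b s (c * s) j.+2 k).
  - exact: (Bump_prod a b s (c * k%:R) j k.+1).
  - exact: (Bump_prod a b s (c * - s) j k.+2).
move=> x /=.
have da : is_derive x 1 (fun x : R => x - a) (1 - 0) by exact: is_deriveB.
have db : is_derive x 1 (fun x : R => b - x) (0 - 1) by exact: is_deriveB.
have dj := @is_derive1_comp _ (flat s j) _ x _ _ (is_derive_flat j (x - a) s0) da.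
have dk := @is_derive1_comp _ (flat s k) _ x _ _ (is_derive_flat k (b - x) s0) db.
have dM := @is_deriveZ _ _ _ _ c _ _ _ (@is_deriveM _ _ _ _ _ _ _ _ dj dk).
eapply is_derive_eq; first exact: dM.
rewrite /GRing.scale /=; ring.
Qed.

Lemma bump_derive1n a b s f n : 0 < s -> bump a b s f -> bump a b s (derive1n n f).
Proof.
move=> s0 bf; elim: n => [//|n IHn]; rewrite derive1nS.
have [g bg dg] := bump_derive s0 IHn.
suff -> : derive1 (derive1n n f) = g by [].
by apply/funext => x; rewrite derive1E; have [_ ->] := dg x.
Qed.

(** Continuity gives a maximum on the compact interval, and the function vanishes off it. *)
Lemma bump_bounded a b s f k : 0 < s -> a < b -> bump a b s f ->
  exists M : R, forall t : R, `|t ^+ k * f t| <= M.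
Proof.
move=> s0 ab bf; pose F t := `|t ^+ k * f t|.
have cF : {within `[a, b], continuous F}.
  apply: continuous_subspaceT => x; apply: cvg_norm; apply: cvgM.
    exact: exprn_continuous.
  have [g _ dg] := bump_derive s0 bf; have [df _] := dg x.
  exact/differentiable_continuous/derivable1_diffP.
have [c _ cmax] := EVT_max (ltW ab) cF.
exists (F c) => t; have [tab|tab] := boolP (a < t < b).
  apply: cmax; rewrite in_itv /=.
  by case/andP: tab => /ltW -> /ltW ->.
by rewrite (bump_eq0 bf tab) mulr0 normr0 normr_ge0.
Qed.

Lemma bump_schwartz a b s f : 0 < s -> a < b -> bump a b s f -> real_schwartz f.
Proof.
move=> s0 ab bf; split=> [n t|k n].
  have [g _ dg] := bump_derive s0 (bump_derive1n n s0 bf).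
  by have [] := dg t.
exact: bump_bounded s0 ab (bump_derive1n n s0 bf).
Qed.

(** Supplies the imaginary part of real test functions. *)
Lemma schwartz0 : real_schwartz (fun _ : R => 0 : R).
Proof.
have -> : (fun _ => 0) = fun x : R => 0 * (flat 1 0 (x - 0) * flat 1 0 (1 - x)).
  by apply/funext => x; rewrite mul0r.
by apply: (@bump_schwartz 0 1 1) => //; exact: Bump_prod.
Qed.

(* The factor 1 makes this literally an instance of [Bump_prod]. *)
Definition plateau (a b : R) (n : nat) (x : R) : R :=
  1 * (flat n.+1%:R^-1 0 (x - a) * flat n.+1%:R^-1 0 (b - x)).

Lemma plateau_schwartz a b n : a < b -> real_schwartz (plateau a b n).
Proof.
by move=> ab; apply: (@bump_schwartz a b n.+1%:R^-1) => //; exact: Bump_prod.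
Qed.

Lemma plateau_ge0 a b n x : 0 <= plateau a b n x.
Proof. by rewrite /plateau mul1r mulr_ge0 // flat_ge0. Qed.

Lemma flat_homo x : {homo (fun n => flat n.+1%:R^-1 0 x) : n m / (n <= m)%N >-> n <= m}.
Proof.
move=> n m nm; rewrite /flat; case: ifP => // x0; rewrite !expr0 !mul1r ler_expR.
by rewrite !mulNr lerN2 ler_wpM2r ?invr_ge0 ?(ltW x0) // lef_pV2 ?posrE ?ler_nat.
Qed.

Lemma plateau_homo a b x : {homo (fun n => plateau a b n x) : n m / (n <= m)%N >-> n <= m}.
Proof.
move=> n m nm; rewrite /plateau !mul1r.
by rewrite ler_pM ?flat_ge0 //; exact: (flat_homo _ nm).
Qed.

Lemma flat_cvg x : flat n.+1%:R^-1 0 x @[n --> \oo] --> ((0 < x)%R%:R : R).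
Proof.
rewrite /flat; case: (0 < x)%R; last exact: cvg_cst.
under eq_fun do rewrite expr0 mul1r mulNr.
rewrite -[1%:R]expR0 -oppr0 -(mul0r x^-1).
apply: continuous_cvg; first exact: continuous_expR.
apply: cvgN; apply: cvgM; [exact: cvg_harmonic|exact: cvg_cst].
Qed.

(** The limit is the open interval because [flat] vanishes at 0. *)
Lemma plateau_cvg a b x : plateau a b n x @[n --> \oo] --> (\1_(`]a, b[%classic) x : R).
Proof.
rewrite /plateau indicE.
have -> : (x \in `]a, b[%classic)%:R = 1 * ((0 < x - a)%R%:R * (0 < b - x)%R%:R) :> R.
  rewrite mem_setE in_itv /= !subr_gt0 mul1r.
  by case: (a < x); case: (x < b); rewrite /= ?mulr0 ?mul0r ?mulr1.
apply: cvgM; first exact: cvg_cst.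
by apply: cvgM; exact: flat_cvg.
Qed.

Lemma schwartz_continuous f : real_schwartz f -> continuous f.
Proof.
move=> [df _] x; exact/differentiable_continuous/derivable1_diffP/(df 0%N).
Qed.

Lemma schwartz_measurable (f : R -> R) :
  real_schwartz f -> measurable_fun [set: measurableTypeR R] f.
Proof. by move=> /schwartz_continuous/continuous_measurable_fun. Qed.

(** Monotone convergence, valid for any measure and later applied to both [mu] and Lebesgue
    measure. *)
Lemma cvg_integral_plateau (mu : {measure set (measurableTypeR R) -> \bar R}) a b :
  a < b ->
  (\int[mu]_x (plateau a b n x)%:E @[n --> \oo] --> mu `]a, b[%classic)%E.
Proof.
move=> ab.
have -> : mu `]a, b[%classic = (\int[mu]_x (\1_(`]a, b[%classic) x)%:E)%E.
  by rewrite integral_indic // setIT.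
have -> : (\int[mu]_x (\1_(`]a, b[%classic) x)%:E =
    \int[mu]_x limn (fun n => (plateau a b n x)%:E))%E.
  apply: eq_integral => x _; apply/esym/cvg_lim => //.
  by apply: cvg_EFin; [exact: nearW|exact: plateau_cvg].
apply: cvg_monotone_convergence => //.
- move=> n; apply/measurable_EFinP.
  by apply: schwartz_measurable; exact: plateau_schwartz.
- by move=> n x _; rewrite lee_fin plateau_ge0.
- by move=> x _ n m nm; rewrite lee_fin; exact: plateau_homo.
Qed.

End bump.

(** * Diffraction *)

Section lebesgue.
Variable R : realType.
Notation leb := (@lebesgue_measure R).
Implicit Types (f : R -> R) (mu : {measure set (measurableTypeR R) -> \bar R}).

Lemma integrable_oneDsqrV : leb.-integrable setT (fun t : R => (oneDsqr t)^-1%:E).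
Proof.
have cV : continuous (fun t : R => (oneDsqr t)^-1) := @continuous_oneDsqrV R.
apply/integrableP; split.
  by apply/measurable_EFinP; exact: continuous_measurable_fun.
under eq_integral do rewrite gee0_abs ?lee_fin ?invr_ge0 //.
rewrite ge0_symfun_integralT //.
- by rewrite -set_itvcy integral0y_oneDsqr -EFinM ltry.
- by move=> x /=; rewrite /oneDsqr sqrrN.
Qed.

(** Bounds on [f] and on [t ^+ 2 * f t] dominate [f] by a multiple of [(oneDsqr t)^-1]. *)
Lemma schwartz_integrable f :
  real_schwartz f -> leb.-integrable setT (fun t => (f t)%:E).
Proof.
move=> sf; have [_ bf] := sf.
have [M0 f0] := bf 0%N 0%N; have [M2 f2] := bf 2 0%N.
apply: (le_integrable measurableT _ _
  (integrableZl measurableT (M0 + M2) integrable_oneDsqrV)).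
  by apply/measurable_EFinP; exact: schwartz_measurable.
move=> t _ /=; rewrite lee_fin; apply: le_trans (ler_norm _).
rewrite ler_pdivlMr ?(lt_le_trans ltr01 (oneDsqr_ge1 t)) //.
rewrite /oneDsqr mulrDr mulr1 lerD //.
  by have := f0 t; rewrite expr0 mul1r.
by have := f2 t; rewrite normrM normrX real_normK ?num_real // mulrC.
Qed.

(** The partial sums are constant on the finite sets containing 0. *)
Lemma cvg_partial_sum_delta0 (r : int -> R) :
  summability.partial_sum (fun m : int => delta0 R m * r m)
    @ summability.totally --> r 0.
Proof.
apply: (@cvg_near_cst _ _ _ _ _ summability.totally_filter).
exists [fset (0 : int)]%fset => // S /fsubsetP S0.
have S00 : 0 \in S by apply: S0; rewrite inE.
rewrite /summability.partial_sum (bigD1 [` S00]%fset) //= /delta0 eqxx mul1r.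
rewrite big1 ?addr0 // => i; rewrite -val_eqE /= => /negbTE ->.
by rewrite mul0r.
Qed.

Lemma comb_pairing_unique (eta : int -> R) (g : R -> R[i]) v w :
  comb_pairing eta g v -> comb_pairing eta g w -> v = w.
Proof.
have uniq (F : {fset int} -> R) (a b : R) : F @ summability.totally --> a ->
    F @ summability.totally --> b -> a = b.
  have FF := fmap_proper_filter F (@summability.totally_filter int).
  by move=> Fa Fb; exact: (cvg_unique _ Fa Fb).
case: v w => [a b] [c d] [re1 im1] [re2 im2].
by congr Complex; [exact: uniq re1 re2|exact: uniq im1 im2].
Qed.

(** The pairing picks out the Fourier transform at frequency 0, which is the integral of [phi]. *)
Lemma fourier_transform_delta0 : fourier_transform_comb (delta0 R) leb.
Proof.
move=> phi [sre sim]; split; first by split; exact: schwartz_integrable.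
have e : cintegral leb phi = fourier phi 0%:~R.
  rewrite /fourier /cintegral; congr Complex; apply: eq_Rintegral => t _;
  by rewrite mulr0 mul0r oppr0 /cis cos0 sin0 mulr1.
by rewrite e; split; exact: cvg_partial_sum_delta0.
Qed.

Lemma fourier_transform_delta0_unique mu :
  fourier_transform_comb (delta0 R) mu ->
  forall S, measurable S -> mu S = leb S.
Proof.
move=> ft.
have int_eq f : real_schwartz f -> (\int[mu]_t (f t)%:E = \int[leb]_t (f t)%:E)%E.
  move=> sf; have sphi : schwartz (fun t => Complex (f t) 0).
    by split => //; exact: schwartz0.
  have [[imu _] pmu] := ft _ sphi.
  have [[ileb _] pleb] := fourier_transform_delta0 sphi.
  have [] := comb_pairing_unique pmu pleb; rewrite /Rintegral => e _.
  (* [Rintegral] only records the [fine] part; integrability makes both sides finite, so equality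
     lifts to the extended reals. *)
  rewrite -[LHS]fineK ?integrable_fin_num // -[RHS]fineK ?integrable_fin_num //.
  by rewrite e.
have oo a b : a < b -> mu `]a, b[%classic = (b - a)%:E.
  move=> ab; have cmu := @cvg_integral_plateau R mu _ _ ab.
  have cleb : (\int[mu]_t (plateau a b n t)%:E @[n --> \oo] --> leb `]a, b[%classic)%E.
    under eq_fun do rewrite (int_eq _ (@plateau_schwartz R a b _ ab)).
    exact: cvg_integral_plateau.
  rewrite (cvg_unique _ cmu cleb) //.
  by rewrite lebesgue_measure_itv /= lte_fin ab.
(* Uniqueness of Lebesgue measure is tested on half-open intervals, so endpoints must have mass 0;
   they lie in open intervals of length [e]. *)
have pt b : mu [set b] = 0%E.
  apply/eqP; rewrite eq_le measure_ge0 andbT; apply/lee_addgt0Pr => e e0.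
  rewrite add0e.
  have lt2 : b - e / 2 < b + e / 2 by rewrite ltrD2l gtrN // divr_gt0.
  apply: (@le_trans _ _ (mu `]b - e / 2, b + e / 2[%classic)).
    apply: le_measure; rewrite ?inE //.
    move=> _ -> /=; rewrite in_itv /=.
    by rewrite gtrBl ltrDl divr_gt0.
  by rewrite oo // lee_fin; lra.
move=> S mS; apply/esym/lebesgue_measure_unique => // _ [[a b] _ <-] /=.
rewrite lebesgue_measure_itv /= lte_fin; case: ltP => [ab|ba].
  rewrite -(setUitv1 true) ?bnd_simp // measureU //; last first.
    by rewrite -(setDitv1r _ b true) setDKI.
  rewrite -[LHS]adde0; congr (_ + _)%E; [exact/esym/oo|exact/esym/pt].
by rewrite set_itv_ge ?measure0 // bnd_simp -leNgt.
Qed.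

Lemma lebesgue_purely_absolutely_continuous mu :
  (forall S, measurable S -> mu S = leb S) -> purely_absolutely_continuous mu.
Proof.
move=> muE; split.
  exists mzero, mzero, mu; split.
  - by move=> S _; rewrite /mzero !add0e.
  - by exists set0.
  - by split => //; exists set0; split; rewrite ?measure0.
  - by move=> E nE S mS SE; rewrite muE //; exact: nE.
move=> pp sc ac [mud [S0 cS0 pp0] [_ [S1 [mS1 leb1 sc0]]] _].
(* A part dominated by [mu] and carried by a Lebesgue null set is zero; for [pp] this set is
   countable, for [sc] it comes from singularity. *)
have concentrated (nu : {measure set (measurableTypeR R) -> \bar R}) T :
    (forall S, measurable S -> (nu S <= mu S)%E) ->
    measurable T -> leb T = 0%E -> nu (~` T) = 0%E -> is_zero_measure nu.
  move=> numu mT T0 nuT S mS.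
  apply/eqP; rewrite eq_le measure_ge0 andbT.
  apply: (@le_trans _ _ (nu T + nu (~` T))%E).
    rewrite -measureU //; [|exact: measurableC|exact: setICr].
    by rewrite setUv; apply: le_measure; rewrite ?inE.
  by rewrite nuT adde0 (le_trans (numu _ mT)) // muE // T0.
split.
- apply: (concentrated _ S0) => //.
  + by move=> S mS; rewrite mud // -addeA leeDl // adde_ge0.
  + exact: countable_measurable.
  + exact: countable_lebesgue_measure0.
- apply: (concentrated _ S1) => //.
  by move=> S mS; rewrite mud // addeAC leeDr // adde_ge0.
Qed.

End lebesgue.

Theorem theorem1 (R : realType) (x : int -> letter) (hx : hull x) :
  (exists mu : {measure set (measurableTypeR R) -> \bar R},
     diffraction_measure x mu) /\
  (forall mu : {measure set (measurableTypeR R) -> \bar R},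
     diffraction_measure x mu -> purely_absolutely_continuous mu).
Proof.
have ac := @hull_autocorrelation R x hx; split.
  by exists (@lebesgue_measure R), (delta0 R); last exact: fourier_transform_delta0.
move=> mu [eta ceta ft].
(* Uniqueness of limits forces the coefficients of every diffraction measure. *)
have etaE : eta = delta0 R.
  by apply/funext => m; exact: (cvg_unique _ (ceta m) (ac m)).
rewrite etaE in ft.
exact/lebesgue_purely_absolutely_continuous/fourier_transform_delta0_unique.
Qed.
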